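(* Let $k$ be a positive integer, $X$ a finite set and $\sigma\in\mathrm{SIM}(X)$ with disjoint path and cycle decomposition $\sigma=\alpha\beta$, where $\alpha$ is the product of the cycles and $\beta$ the product of the paths of the decomposition. Let $A$ be the set of digits of the cycles of $\alpha$ and $B$ the set of digits of the paths of $\beta$ (so $X=A\cup B$ disjointly). Then the number of $k$th roots of $\sigma$ in $\mathrm{SIM}(X)$ equals the number of $\gamma$ in the symmetric group $S_A$ with $\gamma^k=\alpha$ times the number of $\delta\in\mathrm{SIM}(B)$ with $\delta^k=\beta$.
   Context: For a finite set $X$, $\mathrm{SIM}(X)$ is the symmetric inverse monoid: the set of all partial one-to-one maps from $X$ to itself, under composition; $S_A$ is the group of permutations of $A$. For distinct $a_1,\dots,a_\ell$, the path $[a_1a_2\cdots a_\ell]$ is the partial map sending $a_i\mapsto a_{i+1}$ for $i<\ell$ and undefined at $a_\ell$ (so $[a]$ is the nowhere-defined map on $\{a\}$); the cycle $(a_1\cdots a_\ell)$ sends $a_i\mapsto a_{i+1}$ for $i<\ell$ and $a_\ell\mapsto a_1$. Its length is $\ell$ and $a_1,\dots,a_\ell$ are its digits. Paths/cycles are disjoint if their digit sets are disjoint, and a product of disjoint paths/cycles is the partial map on the union of their digits agreeing with each one on its digits. Every element of $\mathrm{SIM}(X)$ is uniquely a product of disjoint paths and cycles whose digit sets partition $X$ (its disjoint path and cycle decomposition, length-one paths and cycles included). A $k$th root of $\sigma\in\mathrm{SIM}(X)$ is an $\alpha'\in\mathrm{SIM}(X)$ with $\alpha'^k=\sigma$. 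*)

(* Defs.v *)
From HB Require Import structures.
From mathcomp Require Import all_boot all_fingroup.

Set Implicit Arguments.
Unset Strict Implicit.
Unset Printing Implicit Defensive.

Local Open Scope group_scope.

(* A partial map from X to itself is a map X -> option X, [None] meaning
   "undefined"; it is one-to-one if it is injective where it is defined. *)
Definition pinjective (X : finType) (f : {ffun X -> option X}) : bool :=
  [forall x, forall y, (f x != None) && (f x == f y) ==> (x == y)].

Record SIM (X : finType) : predArgType :=
  MkSIM { sim_fun :> {ffun X -> option X}; _ : pinjective sim_fun }.

HB.instance Definition _ (X : finType) := [isSub for @sim_fun X].
HB.instance Definition _ (X : finType) := [Finite of SIM X by <:].

Section SIMMonoid.

Variable X : finType.
Implicit Types f g h : SIM X.

Lemma simP f g : f =1 g -> f = g.
Proof. by move=> fg; apply/val_inj/ffunP. Qed.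

Lemma sim_inj f x y z : f x = Some z -> f y = Some z -> x = y.
Proof.
case: f => f /= /forallP /(_ x) /forallP /(_ y) /implyP fI fx fy.
by apply/eqP/fI; rewrite fx fy eqxx.
Qed.

Fact sim_one_subproof : pinjective [ffun x : X => Some x].
Proof.
by apply/forallP=> x; apply/forallP=> y; rewrite !ffunE; apply/implyP.
Qed.

Definition sim_one : SIM X := MkSIM sim_one_subproof.

Fact sim_mul_subproof f g : pinjective [ffun x => obind g (f x)].
Proof.
apply/forallP=> x; apply/forallP=> y; rewrite !ffunE; apply/implyP.
case fx: (f x) => [a|] //=; case ga: (g a) => [b|] //=.
case fy: (f y) => [c|] //= /eqP/esym gc.
by apply/eqP; apply: (sim_inj fx); rewrite fy (sim_inj ga gc).
Qed.

(* As for permutations, [f * g] is "f, then g". *)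
Definition sim_mul f g : SIM X := MkSIM (sim_mul_subproof f g).

Fact sim_mulA : associative sim_mul.
Proof.
move=> f g h; apply: simP => x; rewrite !ffunE.
by case: (f x) => //= a; rewrite ffunE.
Qed.

Fact sim_mul1 : left_id sim_one sim_mul.
Proof. by move=> f; apply: simP => x; rewrite !ffunE. Qed.

Fact sim_mulr1 : right_id sim_one sim_mul.
Proof.
by move=> f; apply: simP => x; rewrite !ffunE; case: (f x) => //= a; rewrite ffunE.
Qed.

HB.instance Definition _ :=
  isMonoid.Build (SIM X) sim_mulA sim_mul1 sim_mulr1.

End SIMMonoid.

Section Decomposition.

Variable X : finType.

(* A nonempty duplicate-free sequence [:: a_1; ...; a_l] represents both the
   path [a_1 ... a_l] and the cycle (a_1 ... a_l); these are the corresponding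
   partial maps, meaningful on the digits of the sequence only. *)
Definition path_pmap (p : seq X) (x : X) : option X := onth p (index x p).+1.
Definition cycle_pmap (c : seq X) (x : X) : option X := Some (next c x).

Definition digits (ss : seq (seq X)) : {set X} := [set x in flatten ss].

(* [sigma] is the product of the cycles in [cs] and of the paths in [ps], which
   are pairwise disjoint and have digit sets partitioning X. *)
Definition disjoint_decomposition (sigma : SIM X) (cs ps : seq (seq X)) : Prop :=
  [/\ [::] \notin cs ++ ps,
      uniq (flatten (cs ++ ps)),
      (forall x, x \in flatten (cs ++ ps)),
      (forall c x, c \in cs -> x \in c -> sigma x = cycle_pmap c x)
    & (forall p x, p \in ps -> x \in p -> sigma x = path_pmap p x)].

(* Each of the following determines the product uniquely. *)
Definition is_cycle_product (cs : seq (seq X))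
    (alpha : {perm {x : X | x \in digits cs}}) : Prop :=
  forall c x, c \in cs -> val x \in c ->
    Some (val (alpha x)) = cycle_pmap c (val x).

Definition is_path_product (ps : seq (seq X))
    (beta : SIM {x : X | x \in digits ps}) : Prop :=
  forall p x, p \in ps -> val x \in p ->
    omap val (beta x) = path_pmap p (val x).

End Decomposition.

Arguments is_cycle_product {X} cs alpha.
Arguments is_path_product {X} ps beta.

(* Main.v *)
Require Import Defs.
From mathcomp Require Import all_boot all_fingroup.

(** The points of [A] are exactly those on which every power of [sigma] is
    defined.  If [a ^+ k = sigma] with [0 < k], every power of [a] is dominated
    by a power of [sigma] and conversely, so these are also the points on which
    every power of [a] is defined.  Applying [a] preserves this property in both
    directions, hence [a] maps [A] into [A] and [B] into [B], and is therefore
    glued from a permutation of [A] and a partial injection of [B].  Gluing is an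
    injective monoid morphism sending [(alpha, beta)] to [sigma]. *)

Set Implicit Arguments.
Unset Strict Implicit.
Unset Printing Implicit Defensive.

Local Open Scope group_scope.

Section Immortal.

Variable X : finType.
Implicit Types (f : SIM X) (x y : X).

Lemma sim_mulE f g x : (f * g) x = obind g (f x).
Proof. by rewrite ffunE. Qed.

Lemma sim_oneE x : (1 : SIM X) x = Some x.
Proof. by rewrite ffunE. Qed.

(** Phrased through powers alone, without a decomposition, so that it can be compared between
    [sigma] and its roots. *)
Definition immortal f x := forall n, (f ^+ n) x != None.

Lemma sim_expg_None f x m n :
  (m <= n)%N -> (f ^+ m) x = None -> (f ^+ n) x = None.
Proof. by move=> /subnKC <- fx; rewrite expgnDr sim_mulE fx. Qed.

(** Powers of [f ^+ k] are powers of [f]; conversely [n <= k * n], and a point where [f ^+ n] is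
    undefined stays so for all higher powers. *)
Lemma immortal_expg f k x : (0 < k)%N -> immortal (f ^+ k) x <-> immortal f x.
Proof.
move=> k_gt0; split=> fx n; last by rewrite -expgnA.
apply: contra_neq (fx n); rewrite -expgnA.
by apply: sim_expg_None; rewrite leq_pmull.
Qed.

Lemma immortal_step f x y : f x = Some y -> immortal f x <-> immortal f y.
Proof.
move=> fxy; have fE n : (f ^+ n.+1) x = (f ^+ n) y.
  by rewrite expgS sim_mulE fxy.
split=> [fx n | fy [|n]]; first by rewrite -fE.
  by rewrite expg0 sim_oneE.
by rewrite fE.
Qed.

Lemma immortal_defined f x : immortal f x -> exists y, f x = Some y.
Proof.
by move=> /(_ 1%N); rewrite expg1; case: (f x) => // y; exists y.
Qed.

Lemma stable_immortal f (A : {set X}) :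
  (forall x, x \in A -> exists2 y, y \in A & f x = Some y) ->
  forall x, x \in A -> immortal f x.
Proof.
move=> fA x + n; elim: n x => [|n IHn] x Ax; first by rewrite expg0 sim_oneE.
by have [y Ay fxy] := fA x Ax; rewrite expgS sim_mulE fxy IHn.
Qed.

Lemma path_pmap_onth (p : seq X) x y :
  uniq p -> path_pmap p x = Some y -> (y \in p) /\ index y p = (index x p).+1.
Proof.
rewrite /path_pmap => Up pxy; have lt_p : ((index x p).+1 < size p)%N.
  by rewrite -onthTE pxy.
by rewrite -(onth_nth x _ _ _ pxy) mem_nth // index_uniq.
Qed.

(** Each application of [f] moves one place along [p], so the distance to the end strictly decreases
    and an immortal digit would give an infinite descent. *)
Lemma path_mortal f (p : seq X) x :
  uniq p -> (forall y, y \in p -> f y = path_pmap p y) -> x \in p ->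
  ~ immortal f x.
Proof.
move=> Up fp; have [n] := ubnP (size p - index x p).
elim: n x => // n IHn x; rewrite ltnS => lt_n px fx; have [y fxy] := immortal_defined fx.
have fy := (immortal_step fxy).1 fx.
have [py iy] := path_pmap_onth Up (etrans (esym (fp x px)) fxy).
apply: IHn py fy; rewrite iy; apply: leq_trans lt_n.
by rewrite ltn_sub2l // index_mem.
Qed.

End Immortal.

Section Glue.

Variables (X : finType) (A B : {set X}).
Hypothesis AB : forall x, (x \in B) = (x \notin A).

Let TA := {x : X | x \in A}.
Let TB := {x : X | x \in B}.

Definition glue_fun (g : {perm TA}) (d : SIM TB) : {ffun X -> option X} :=
  [ffun x => if insub x : option TA is Some u then Some (val (g u))
             else obind (fun v => omap val (d v)) (insub x : option TB)].

(** Case analysis that replaces a point by the [val] of a subtype element, the form in which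
    [glue_funA] and [glue_funB] rewrite. *)
Variant glue_spec : X -> Type :=
  | GlueA (u : TA) : glue_spec (val u)
  | GlueB (v : TB) : glue_spec (val v).

Lemma glueP x : glue_spec x.
Proof.
case Ax: (x \in A); first exact: (GlueA (exist _ x Ax)).
have Bx : x \in B by rewrite AB Ax.
exact: (GlueB (exist _ x Bx)).
Qed.

Lemma glue_funA g d (u : TA) : glue_fun g d (val u) = Some (val (g u)).
Proof. by rewrite ffunE valK. Qed.

Lemma glue_funB g d (v : TB) : glue_fun g d (val v) = omap val (d v).
Proof.
rewrite ffunE valK insubF //; apply: negbTE.
by rewrite -AB; apply: valP.
Qed.

Lemma val_AB (u : TA) (v : TB) : val u <> val v.
Proof. by move=> uv; have := valP v; rewrite /= AB -uv (valP u). Qed.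

(** Values at points of [A] lie in [A] and values at points of [B] lie in [B], so a collision can
    only occur within one block. *)
Lemma glue_subproof g d : pinjective (glue_fun g d).
Proof.
apply/forallP=> x; apply/forallP=> y; apply/implyP=> /andP[].
case: (glueP x) => [u|u]; case: (glueP y) => [v|v];
  rewrite ?glue_funA ?glue_funB.
- by move=> _ /eqP[/val_inj/perm_inj->].
- by move=> _; case: (d v) => //= w /eqP[/val_AB].
- by case: (d u) => //= w _ /eqP[/esym/val_AB].
case du: (d u) => [w|] //= _; case dv: (d v) => [z|] //= /eqP[/val_inj wz].
by rewrite -wz in dv; rewrite (sim_inj du dv).
Qed.

Definition glue g d : SIM X := MkSIM (glue_subproof g d).

Lemma glueM g g' d d' : glue (g * g') (d * d') = glue g d * glue g' d'.
Proof.
apply: simP => x; rewrite sim_mulE /=.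
case: (glueP x) => [u|v]; rewrite ?glue_funA ?glue_funB /=.
  by rewrite glue_funA permM.
by rewrite sim_mulE; case: (d v) => //= w; rewrite glue_funB.
Qed.

Lemma glue1 : glue 1 1 = 1.
Proof.
apply: simP => x; rewrite sim_oneE /=.
case: (glueP x) => [u|v]; rewrite ?glue_funA ?glue_funB ?perm1 //.
by rewrite sim_oneE.
Qed.

Lemma glueX g d n : glue (g ^+ n) (d ^+ n) = glue g d ^+ n.
Proof.
by elim: n => [|n IHn]; rewrite ?expg0 ?glue1 // !expgS glueM IHn.
Qed.

Lemma glue_inj g g' d d' : glue g d = glue g' d' -> g = g' /\ d = d'.
Proof.
move=> e; have eqx x : glue_fun g d x = glue_fun g' d' x.
  by have := congr1 (fun f : SIM X => f x) e.
split.
  apply/permP=> u; have := eqx (val u).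
  by rewrite !glue_funA => -[/val_inj].
apply: simP => v; have := eqx (val v); rewrite !glue_funB.
exact: (inj_omap val_inj).
Qed.

(** On [A] the map restricts to an injective self-map of a finite set, hence a permutation. *)
Lemma glue_onto (f : SIM X) :
  (forall x, x \in A -> exists2 y, y \in A & f x = Some y) ->
  (forall x y, x \in B -> f x = Some y -> y \in B) ->
  exists g d, f = glue g d.
Proof.
move=> fA fB.
have fAT (u : TA) : {w : TA | f (val u) == Some (val w)}.
  apply: sigW; have [y Ay fy] := fA _ (valP u).
  by exists (exist _ y Ay); rewrite fy.
pose g u := sval (fAT u).
have gE u : f (val u) = Some (val (g u)) by exact/eqP/(svalP (fAT u)).
have gI : injective g.
  by move=> u v guv; apply/val_inj/(sim_inj (gE u)); rewrite gE guv.
(* [insub] would discard values outside [B]; by [fB] there are none. *)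
pose d : {ffun TB -> option TB} := [ffun v => obind insub (f (val v))].
have dE v : omap val (d v) = f (val v).
  rewrite ffunE; case fv: (f (val v)) => [y|] //=.
  by rewrite (insubT (fun x => x \in B) (fB _ _ (valP v) fv)).
have dI : pinjective d.
  apply/forallP=> u; apply/forallP=> v; apply/implyP=> /andP[+ /eqP duv].
  case du: (d u) => [w|] // _; apply/eqP/val_inj.
  by apply: (@sim_inj _ f _ _ (val w)); rewrite -dE -?duv du.
exists (perm gI), (MkSIM dI); apply: simP => x /=.
case: (glueP x) => [u|v]; first by rewrite glue_funA permE.
by rewrite glue_funB /= dE.
Qed.

Lemma card_glue_roots k (sigma : SIM X) alpha beta :
  (0 < k)%N -> sigma = glue alpha beta ->
  (forall x, x \in B -> ~ immortal sigma x) ->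
  #|[set a : SIM X | a ^+ k == sigma]| =
  (#|[set g : {perm TA} | g ^+ k == alpha]| *
   #|[set d : SIM TB | d ^+ k == beta]|)%N.
Proof.
(* The product counts pairs of roots; gluing is injective, so it remains to identify its image with
   the roots of [sigma]. *)
move=> k_gt0 sE sB; rewrite -cardsX -(card_in_imset (f := fun p => glue p.1 p.2)).
  have sA x : x \in A -> immortal sigma x.
    apply: stable_immortal => {}x Ax; exists (val (alpha (exist _ x Ax))).
      exact: valP.
    by rewrite sE -(glue_funA _ beta).
  congr #|pred_of_set _|; apply/setP=> a; rewrite inE; apply/eqP/imsetP.
    (* A root has the same immortal points as [sigma], namely [A]; this yields both stability
       conditions of [glue_onto]. *)
    move=> ak; have aI x : immortal a x <-> x \in A.
      apply: iff_trans (iff_sym (immortal_expg a x k_gt0)) _; rewrite ak.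
      split=> [sx|]; last exact: sA.
      by apply/negPn; rewrite -AB; apply/negP=> /sB.
    have [|x y|g [d aE]] := @glue_onto a.
    + move=> x /aI ax; have [y axy] := immortal_defined ax.
      by exists y => //; apply/aI/(immortal_step axy).1.
    + rewrite !AB => + axy; apply: contra => /aI ay.
      exact/aI/(immortal_step axy).2.
    exists (g, d) => //; move: ak; rewrite aE -glueX sE => /glue_inj[ag bd].
    by rewrite !inE /= ag bd !eqxx.
  by case=> -[g d]; rewrite !inE /= => /andP[/eqP gk /eqP dk] ->; rewrite -glueX gk dk.
by move=> [g d] [g' d'] _ _ /= /glue_inj[-> ->].
Qed.

End Glue.

Theorem theorem2 (k : nat) (X : finType) (sigma : SIM X) (cs ps : seq (seq X))
    (alpha : {perm {x : X | x \in digits cs}})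
    (beta : SIM {x : X | x \in digits ps}) :
  (0 < k)%N ->
  disjoint_decomposition sigma cs ps ->
  is_cycle_product cs alpha ->
  is_path_product ps beta ->
  #|[set a : SIM X | (a ^+ k)%g == sigma]| =
  (#|[set g : {perm {x : X | x \in digits cs}} | (g ^+ k)%g == alpha]| *
   #|[set d : SIM {x : X | x \in digits ps} | (d ^+ k)%g == beta]|)%N.
Proof.
move=> k_gt0 [_ Ucp cover_cp s_cs s_ps] alphaE betaE.
(* Disjointness comes from the absence of repeated digits, exhaustion from the covering of [X]. *)
have AB x : (x \in digits ps) = (x \notin digits cs).
  rewrite !inE; move: Ucp (cover_cp x); rewrite flatten_cat cat_uniq mem_cat.
  case/and3P=> _ /hasPn/(_ x) disj _; case px: (x \in flatten ps).
    by move/disj: px.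
  by rewrite orbF => ->.
apply: (card_glue_roots (AB := AB)) => // [|x].
  apply: simP => x /=; case: (glueP AB x) => [u|v].
    have := valP u; rewrite /= inE => /flattenP[c cs_c cu].
    by rewrite glue_funA (alphaE c) // (s_cs c).
  have := valP v; rewrite /= inE => /flattenP[p ps_p pv].
  by rewrite glue_funB // (betaE p) // (s_ps p).
rewrite inE => /flattenP[p ps_p px]; apply: (path_mortal (p := p)) => //.
  (* A member of a family whose concatenation is duplicate-free is itself duplicate-free. *)
  have {ps_p}: p \in cs ++ ps by rewrite mem_cat ps_p orbT.
  elim: (cs ++ ps) Ucp => //= q ss IHs; rewrite cat_uniq => /and3P[Uq _ Us].
  by rewrite inE => /predU1P[-> | /(IHs Us)].
by move=> y; apply: s_ps.
Qed.
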